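(* $\gamma(F_{3,2})=\frac{1}{3}$, i.e. $\lim_{n\to\infty}\frac{\mathrm{coex}(n,\{F_{3,2}\})}{n-2}=\frac13$.
   Context: A $3$-graph is a pair $G=(V,E)$ with $E$ a set of $3$-element subsets of $V$. The codegree $d(x,y)$ of distinct vertices $x,y$ is the number of $3$-edges containing both; the minimum codegree $\delta_2(G)$ is the minimum of $d(x,y)$ over all pairs of distinct vertices. $G$ is $\mathcal F$-free if no member of the family $\mathcal F$ is isomorphic to a subgraph of $G$. $F_{3,2}$ is the $3$-graph on $\{1,2,3,4,5\}$ with $3$-edges $123,124,125,345$. For a family $\mathcal F$ of nonempty $3$-graphs, $\mathrm{coex}(n,\mathcal F)$ is the maximum of $\delta_2(G)$ over all $\mathcal F$-free $3$-graphs $G$ on $n$ vertices, and the codegree density is $\gamma(\mathcal F)=\lim_{n\to\infty}\mathrm{coex}(n,\mathcal F)/(n-2)$ (this limit exists). *)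

(* Defs.v *)
From HB Require Import structures.
From mathcomp Require Import all_boot all_order all_algebra.
From mathcomp Require Import all_classical all_reals all_analysis.
Import Order.TTheory GRing.Theory Num.Theory.
Import numFieldNormedType.Exports.

Set Implicit Arguments.
Unset Strict Implicit.
Unset Printing Implicit Defensive.

Local Open Scope nat_scope.

Record threegraph (V : finType) := ThreeGraph {
  edges :> {set {set V}};
  edges_card3 : [forall e in edges, #|e| == 3] }.

HB.instance Definition _ (V : finType) := [isSub for @edges V].
HB.instance Definition _ (V : finType) := [Finite of threegraph V by <:].

Definition codegree (V : finType) (G : threegraph V) (x y : V) : nat :=
  #|[set e in edges G | (x \in e) && (y \in e)]|.

(* Codegrees never exceed #|V|, so the seed #|V| of the iterated minimum only
   matters when V has fewer than two elements and there are no pairs. *)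
Definition min_codegree (V : finType) (G : threegraph V) : nat :=
  \big[minn/#|V|]_(p : V * V | p.1 != p.2) codegree G p.1 p.2.

(* The copy of H under an injection f of the vertices, i.e. the 3-graph with
   vertex set f(U) and edges f(e), is a subgraph of G. *)
Definition contains_copy (U V : finType) (H : threegraph U)
    (G : threegraph V) : Prop :=
  exists f : U -> V,
    injective f /\ [set f @: e | e : {set U} in edges H] \subset edges G.

Definition graph_family : Type := {U : finType & threegraph U} -> Prop.

Definition family_free (F : graph_family) (V : finType) (G : threegraph V) : Prop :=
  forall H, F H -> ~ contains_copy (tagged H) G.

(* Freeness and minimum codegree are isomorphism invariant, so it suffices to
   range over the 3-graphs with vertex set 'I_n. *)
Definition coex (n : nat) (F : graph_family) : nat :=
  \max_(G : threegraph 'I_n | `[< family_free F G >]) min_codegree G.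

(* The subtraction is in R; the finitely many terms n <= 2 do not affect the
   limit. *)
Definition codegree_ratio (R : realType) (F : graph_family) : R^nat :=
  fun n : nat => ((coex n F)%:R / (n%:R - 2))%R.

Definition codegree_density (R : realType) (F : graph_family) : R :=
  limn (codegree_ratio R F).

(* The vertices 1, ..., 5 are represented by 0, ..., 4. *)
Definition F32_edges : {set {set 'I_5}} :=
  [set [set inord 0; inord 1; inord 2];
       [set inord 0; inord 1; inord 3];
       [set inord 0; inord 1; inord 4];
       [set inord 2; inord 3; inord 4]].

Lemma F32_card3 : [forall e in F32_edges, #|e| == 3].
Proof.
apply/'forall_implyP => e; rewrite !inE -!orbA.
by case/or4P => /eqP ->; rewrite -finset.setUA !cardsU1 cards1 !inE -!val_eqE /= !inordK.
Qed.

Definition F32 : threegraph 'I_5 := ThreeGraph F32_card3.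

Definition F32_family : graph_family :=
  fun H => H = Tagged (fun U : finType => threegraph U) F32.

(* Main.v *)
(** Upper bound.  Suppose that the minimum codegree d of an F32-free G on n
    vertices satisfies 3 d >= (1 + 1/e) n, and call w an apex of a vertex set A
    if w a b is an edge for all distinct a, b in A.  For every k >= 3 and every r
    there is, once n is large, a k-set with r apexes.  This goes by induction on
    k: take a set R of r apexes of the k-set A, and weight each vertex w by its
    numbers of edges w x y, w x l and w b c with x, y in R and l, b, c in A.
    F32-freeness and Turan's theorem bound the weight of every w whose link has
    no K_(k+1) inside R, while the codegree condition makes the total weight too
    large for all w to be of this kind.  So linearly many links contain a K_(k+1)
    inside R, and by pigeonhole many of them contain the same one.  For k = 3 one
    starts from R inside a neighbourhood, which is independent.  Finally, if A is
    large and x, y are two of its apexes, then the neighbourhood of x y, the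
    neighbourhood of a pair of A, and the set of w having two edges x a w with a
    in the rest of A are disjoint and have sizes at least d, d and d - n/k, so
    3 d <= (1 + 1/k) n, a contradiction for k > e.

    Lower bound.  Split the vertices into three cyclically ordered equal classes
    and take the triples with two vertices in a class and one in the next. *)

Require Import Defs.
From HB Require Import structures.
From mathcomp Require Import all_boot all_order all_algebra.
From mathcomp Require Import all_classical all_reals all_analysis.
From mathcomp Require Import zify ring lra.
Import Order.TTheory GRing.Theory Num.Theory.
Import numFieldNormedType.Exports.

Set Implicit Arguments.
Unset Strict Implicit.
Unset Printing Implicit Defensive.
Local Open Scope nat_scope.

(** * Turán's theorem, counted over ordered pairs *)

Definition clique (T : finType) (e : rel T) (K : {set T}) : bool :=
  [forall x in K, forall y in K, (x != y) ==> e x y].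

Lemma cliqueP (T : finType) (e : rel T) (K : {set T}) :
  reflect {in K &, forall x y, x != y -> e x y} (clique e K).
Proof.
apply: (iffP forall_inP) => H x; last first.
  by move=> xK; apply/forall_inP => y yK; apply/implyP; exact: H.
by move=> y xK yK; apply/implyP; move/forall_inP: (H x xK); exact.
Qed.

(** The double sum is twice the number of edges inside [P]. Induction on [j]: the neighbourhood [N]
    of a vertex of maximum degree satisfies the hypothesis for the preceding [j], and every edge not
    inside [N] is paid for by the degrees in [B], which are at most [#|N|]. *)
Lemma turan (T : finType) (e : rel T) (j : nat) (P : {set T}) :
  symmetric e -> irreflexive e ->
  (forall K : {set T}, K \subset P -> clique e K -> #|K| != j.+2) ->
  j.+1 * (\sum_(x in P) \sum_(y in P) e x y) <= j * #|P| ^ 2.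
Proof.
move=> es ei; elim: j P => [|j IH] P noK.
  rewrite mul1n mul0n leqn0 sum_nat_eq0; apply/forall_inP => x xP.
  rewrite sum_nat_eq0; apply/forall_inP => y yP; rewrite eqb0; apply/negP => xy.
  refine (negP (noK [set x; y] _ _) _).
  - by apply/fintype.subsetP => z; rewrite !inE => /orP[]/eqP->.
  - apply/cliqueP => a b; rewrite !inE => /orP[]/eqP-> /orP[]/eqP->;
      by rewrite ?eqxx // es.
  - have -> // : #|[set x; y]| = 2.
    by rewrite cards2; case: (x =P y) xy => // ->; rewrite ei.
have [->|[x0 x0P]] := finset.set_0Vmem P.
  by rewrite big_set0 muln0.
pose deg x := \sum_(y in P) e x y.
have degE x : deg x = #|[set y in P | e x y]|.
  by rewrite -sum1dep_card big_mkcondr; apply: eq_bigr => y _; case: (e x y).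
pose v := [arg max_(x > x0 in P) deg x].
have [vP vmax] : v \in P /\ forall x, x \in P -> deg x <= deg v.
  by rewrite /v; case: arg_maxnP.
pose N := [set y in P | e v y]; pose B := P :\: N.
have NP : N \subset P by apply/fintype.subsetP => y; rewrite inE => /andP[].
have splitP (F : T -> nat) : \sum_(y in P) F y = \sum_(y in N) F y + \sum_(y in B) F y.
  rewrite (bigID (mem N)) /=; congr (_ + _); apply: eq_bigl => y.
    by rewrite inE; case: (y \in P); case: (e v y).
  by rewrite !inE; case: (y \in P); case: (e v y).
have HB : \sum_(x in B) deg x <= #|B| * #|N|.
  rewrite -sum_nat_const; apply: leq_sum => x; rewrite inE => /andP[_ xP].
  by rewrite (leq_trans (vmax x xP)) // degE.
have HNB : \sum_(x in N) \sum_(y in B) e x y <= #|B| * #|N|.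
  apply: leq_trans HB; rewrite exchange_big /=; apply: leq_sum => x _.
  by rewrite /deg splitP; under eq_bigr do rewrite es; exact: leq_addr.
have HN : j.+1 * (\sum_(x in N) \sum_(y in N) e x y) <= j * #|N| ^ 2.
  apply: IH => K KN /cliqueP cK; apply/negP => /eqP K2.
  have vK : v \notin K.
    by apply/negP => /(fintype.subsetP KN); rewrite inE ei andbF.
  refine (negP (noK (v |: K) _ _) _).
  - by rewrite finset.subUset finset.sub1set vP (fintype.subset_trans KN NP).
  - apply/cliqueP => x y; rewrite !inE => /predU1P[->|xK] /predU1P[->|yK].
    + by rewrite eqxx.
    + by have := fintype.subsetP KN y yK; rewrite inE => /andP[].
    + by have := fintype.subsetP KN x xK; rewrite inE es => /andP[].
    + exact: cK.
  - by rewrite cardsU1 vK K2.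
have cP : #|P| = #|N| + #|B|.
  by have := cardsID N P; rewrite (finset.setIidPr NP) => <-.
have -> : \sum_(x in P) \sum_(y in P) e x y = \sum_(x in N) \sum_(y in N) e x y +
    \sum_(x in N) \sum_(y in B) e x y + \sum_(x in B) deg x.
  rewrite splitP; congr (_ + _); rewrite -big_split.
  by apply: eq_bigr => x _; rewrite splitP.
rewrite cP; move: HB HNB HN.
move: (\sum_(x in N) \sum_(y in N) _) (\sum_(x in N) _) (\sum_(x in B) _) => f g h.
move: #|B| #|N| => b a hba gba fa.
rewrite -(leq_pmul2l (ltn0Sn j)).
have -> : j.+1 * (j.+2 * (f + g + h)) = j.+2 * (j.+1 * f) + j.+1 * j.+2 * (g + h) by ring.
apply: (@leq_trans (j.+2 * (j * a ^ 2) + j.+1 * j.+2 * (2 * (b * a)))).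
  by apply: leq_add; rewrite leq_mul2l ?fa //; lia.
(* The two sides of the goal differ by the square of [a - (j+1) b]. *)
suff : 2 * (a * (j.+1 * b)) <= a ^ 2 + (j.+1 * b) ^ 2 by nia.
exact: nat_Cauchy.
Qed.

(** * Edges as vertex triples, neighbourhoods, and copies of [F32] *)

Definition edge3 (V : finType) (G : threegraph V) (x y z : V) : bool :=
  [set x; y; z] \in edges G.

Definition nbhd (V : finType) (G : threegraph V) (x y : V) : {set V} :=
  [set z | edge3 G x y z].

Lemma edge3_swap12 (V : finType) (G : threegraph V) x y z :
  edge3 G x y z = edge3 G y x z.
Proof. by rewrite /edge3 (finset.setUC [set x]). Qed.

Lemma edge3_swap23 (V : finType) (G : threegraph V) x y z :
  edge3 G x y z = edge3 G x z y.
Proof. by rewrite /edge3 finset.setUAC. Qed.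

Lemma edge3_rot (V : finType) (G : threegraph V) x y z :
  edge3 G x y z = edge3 G y z x.
Proof. by rewrite edge3_swap12 edge3_swap23. Qed.

Lemma cards3 (T : finType) (x y z : T) :
  (#|[set x; y; z]| == 3) = uniq [:: x; y; z].
Proof.
rewrite -finset.setUA cardsU1 cards2 /= !inE andbT.
by case: (x == y); case: (x == z); case: (y == z).
Qed.

Lemma edge3_uniq (V : finType) (G : threegraph V) x y z :
  edge3 G x y z -> uniq [:: x; y; z].
Proof. by move=> /(forall_inP (edges_card3 G)); rewrite cards3. Qed.

Lemma edge3_neq (V : finType) (G : threegraph V) x y z :
  edge3 G x y z -> [/\ x != y, x != z & y != z].
Proof. by move=> /edge3_uniq; rewrite /= !inE negb_or andbT => /andP[/andP[]]. Qed.

Lemma codegree_nbhd (V : finType) (G : threegraph V) x y :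
  x != y -> codegree G x y = #|nbhd G x y|.
Proof.
move=> xy; rewrite /codegree -[RHS](@card_in_imset _ _ (fun z => [set x; y; z])).
  apply: eq_card => e; apply/idP/imsetP.
    rewrite inE => /and3P[eG xe ye].
    have /eqP e3 := forall_inP (edges_card3 G) _ eG.
    have : #|e :\ x :\ y| == 1.
      have := cardsD1 y (e :\ x); have := cardsD1 x e.
      by rewrite !inE xe ye e3 (eq_sym y) xy /=; lia.
    move=> /cards1P[z ez].
    have E : e = [set x; y; z].
      by rewrite -finset.setUA -ez finset.setD1K ?finset.setD1K // !inE eq_sym xy ye.
    by exists z => //; rewrite inE /edge3 -E.
  by move=> [z]; rewrite !inE => zG ->; rewrite !inE !eqxx orbT /= andbT.
move=> z w; rewrite !inE => /edge3_neq[_ xz yz] _ /finset.setP /(_ z).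
by rewrite !inE !(eq_sym z) (negbTE xz) (negbTE yz) eqxx /= eq_sym => /esym/eqP.
Qed.

Lemma min_codegree_le (V : finType) (G : threegraph V) x y :
  x != y -> min_codegree G <= #|nbhd G x y|.
Proof.
move=> xy; rewrite -codegree_nbhd // /min_codegree.
have : (x, y) \in index_enum (V * V)%type by exact: mem_index_enum.
rewrite unlock /=; elim: index_enum => //= p r IH; rewrite inE => /predU1P[<-|/IH].
  by rewrite /= xy geq_minl.
case: ifP => // _; exact: leq_trans (geq_minr _ _).
Qed.

Lemma leq_min_codegree (V : finType) (G : threegraph V) d :
  d <= #|V| -> (forall x y, x != y -> d <= #|nbhd G x y|) -> d <= min_codegree G.
Proof.
move=> dV H; rewrite /min_codegree; elim/big_rec: _ => // p m pn dm.
by rewrite leq_min dm andbT codegree_nbhd //; exact: H.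
Qed.

(** Any two of the five vertices lie in a common edge of [F32], so the four edges already force
    [x, y, a, b, c] to be distinct. *)
Lemma F32_copyP (V : finType) (G : threegraph V) :
  contains_copy F32 G <->
  exists x y a b c, [/\ edge3 G x y a, edge3 G x y b, edge3 G x y c & edge3 G a b c].
Proof.
have im (f : 'I_5 -> V) (i j k : 'I_5) :
    f @: [set i; j; k] = [set f i; f j; f k] by rewrite !imsetU !imset_set1.
split=> [[f [finj sub]]|[x [y [a [b [c [xya xyb xyc abc]]]]]]].
  exists (f (inord 0)), (f (inord 1)), (f (inord 2)), (f (inord 3)), (f (inord 4)).
  split; rewrite /edge3 -im; apply: (fintype.subsetP sub); apply: imset_f;
    by rewrite /F32 /= /F32_edges !inE eqxx ?orbT.
pose f (i : 'I_5) := nth x [:: x; y; a; b; c] i.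
have fE i : i < 5 -> f (inord i) = nth x [:: x; y; a; b; c] i by move=> i5; rewrite /f inordK.
have u : uniq [:: x; y; a; b; c].
  have [xy xa ya] := edge3_neq xya.
  have [_ xb yb] := edge3_neq xyb.
  have [_ xc yc] := edge3_neq xyc.
  have [ab ac bc] := edge3_neq abc.
  by rewrite /= !inE !negb_or xy xa ya xb yb xc yc ab ac bc.
exists f; split.
  by move=> i j /eqP; rewrite /f nth_uniq // => /eqP /val_inj.
apply/fintype.subsetP => e' /imsetP[e eF ->]; move: eF.
rewrite /F32 /= /F32_edges !inE -!orbA.
by case/or4P => /eqP ->; rewrite im !fE.
Qed.

(** In the upper bound freeness enters only through this form: a pair is exhibited with three
    neighbours that form an edge. *)
Lemma F32_freeP (V : finType) (G : threegraph V) :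
  family_free F32_family G <-> forall x y a b c,
    edge3 G x y a -> edge3 G x y b -> edge3 G x y c -> ~~ edge3 G a b c.
Proof.
split=> [free x y a b c xya xyb xyc|free H ->].
  apply/negP => abc; apply: (free _ (erefl _)); apply/F32_copyP.
  by exists x, y, a, b, c.
by move=> /F32_copyP[x [y [a [b [c [xya xyb xyc]]]]]]; apply/negP; exact: (free x y).
Qed.

(** * Apexes, and the inequality for two apexes of one set *)

Definition apexes (V : finType) (G : threegraph V) (K : {set V}) : {set V} :=
  [set w | clique (edge3 G w) K].

(** Two vertices [a1], [a2] of [A] supply a pair and the other [k] form the list [t]. The claim is
    [k] times [le3] combined with [leP]. *)
Lemma double_cone_bound (V : finType) (G : threegraph V) (A : {set V}) (x y : V) (k : nat) :
  family_free F32_family G -> x != y -> #|A| = k.+2 ->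
  x \in apexes G A -> y \in apexes G A ->
  3 * k * min_codegree G <= k.+1 * #|V|.
Proof.
move=> /F32_freeP free xy cA; rewrite !inE => /cliqueP xA /cliqueP yA.
have : pairwise (fun a b => edge3 G x a b && edge3 G y a b) (enum A).
  have := enum_uniq (mem A); rewrite uniq_pairwise.
  apply: (sub_in_pairwise (P := mem A)) => [a b aA bA ab|].
    by rewrite xA ?yA.
  by apply/allP => a; rewrite mem_enum.
move: cA; rewrite cardE; case: (enum _) => [|a1 [|a2 t]] //= [st].
move=> /andP[/andP[/andP[x12 y12] /allP c1] /andP[/allP c2 ct]].
pose P := [set w | 1 < count (fun a => edge3 G x a w) t].
have a12 : a1 != a2 by have [] := edge3_neq x12.
(* For a common [w], the pair [(a1, a2)] has the neighbours [x, y, w]. *)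
have D1 : [disjoint nbhd G x y & nbhd G a1 a2].
  apply/pred0P => w /=; apply/negbTE; rewrite !inE; apply/negP => /andP[xyw aw].
  have := free a1 a2 x y w.
  by rewrite -(edge3_rot _ x) -(edge3_rot _ y) x12 y12 aw xyw => /(_ isT isT isT).
(* Let [w] be in [P]. If [xyw] is an edge, the pair [(x, w)] has the neighbours [y, a, b] for two
   [a, b] in [t]; if [a1 a2 w] is an edge, the pair [(x, a)] has the neighbours [a1, a2, w]. *)
have D2 : [disjoint nbhd G x y :|: nbhd G a1 a2 & P].
  apply/pred0P => w /=; apply/negbTE; rewrite !inE; apply/negP => /andP[].
  move=> H Pw; case/orP: H => [xyw|aw].
    have := filter_subseq (fun a => edge3 G x a w) t.
    have := filter_all (fun a => edge3 G x a w) t.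
    move: Pw; rewrite -size_filter; case: (seq.filter _ _) => [|a [|b u]] //= _ /and3P[xaw xbw _].
    move=> /subseq_pairwise /(_ ct) /= /andP[/andP[/andP[_ yab] _] _].
    have := free x w y a b; rewrite !(edge3_swap23 _ x w) xyw xaw xbw yab.
    by move=> /(_ isT isT isT).
  have /hasP[a at_ xaw] : has (fun a => edge3 G x a w) t by rewrite has_count ltnW.
  have /andP[x1a _] := c1 a at_; have /andP[x2a _] := c2 a at_.
  have := free x a a1 a2 w; rewrite !(edge3_swap23 _ x a) x1a x2a aw.
  by rewrite -(edge3_swap23 _ x a) xaw => /(_ isT isT isT).
have le3 : 2 * min_codegree G + #|P| <= #|V|.
  apply: leq_trans (max_card (mem (nbhd G x y :|: nbhd G a1 a2 :|: P))).
  rewrite !cardsU (finset.disjoint_setI0 D1) (finset.disjoint_setI0 D2) !cards0 !subn0.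
  rewrite mul2n -addnn leq_add2r leq_add // min_codegree_le //.
(* Double counting of the edges [xaw] with [a] in [t]: a vertex [w] outside [P] is counted at most
   once, one in [P] at most [k] times. *)
have leP : k * min_codegree G <= k * #|P| + #|V|.
  apply: (@leq_trans (\sum_w count (fun a => edge3 G x a w) t)).
    rewrite -st -sum1_size big_distrl /=.
    under [leqRHS]eq_bigr do rewrite -sum1_count big_mkcond.
    rewrite exchange_big /= !big_seq; apply: leq_sum => a at_; rewrite mul1n.
    have /andP[/edge3_neq[xa _ _] _] : edge3 G x a a1 && true.
      by have /andP[] := c1 a at_; rewrite edge3_swap23 => ->.
    apply: leq_trans (min_codegree_le _ xa) _.
    by rewrite -sum1_card big_mkcond leq_sum // => w _; rewrite inE.
  apply: (@leq_trans (\sum_w (k * (w \in P) + 1))).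
    apply: leq_sum => w _; rewrite inE; case: ltnP => [_|]; last by rewrite muln0.
    by rewrite muln1; apply: leq_trans (count_size _ _) _; rewrite st leq_addr.
  rewrite big_split /= sum1_card leq_add2r -big_distrr /= -sum1_card.
  by rewrite (big_mkcond (mem P)) leq_mul2l leq_sum ?orbT // => w _; case: ifP.
have arith m p n : 2 * m + p <= n -> k * m <= k * p + n -> 3 * k * m <= k.+1 * n.
  by nia.
exact: arith le3 leP.
Qed.

(** * Weights on links, and the growth of sets with many apexes *)

Lemma edge3_sym (V : finType) (G : threegraph V) w : symmetric (edge3 G w).
Proof. by move=> x y; exact: edge3_swap23. Qed.

Lemma edge3_irr (V : finType) (G : threegraph V) w : irreflexive (edge3 G w).
Proof. by move=> x; apply/negP => /edge3_neq[_ _]; rewrite eqxx. Qed.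

Lemma sum_edge3 (V : finType) (G : threegraph V) x y :
  \sum_w edge3 G w x y = #|nbhd G x y|.
Proof.
rewrite -sum1_card [RHS]big_mkcond; apply: eq_bigr => w _.
by rewrite inE edge3_rot; case: edge3.
Qed.

Lemma subset_card (T : finType) (A : {set T}) r :
  r <= #|A| -> exists2 B : {set T}, B \subset A & #|B| = r.
Proof.
move=> rA; exists [set x in take r (enum A)].
  by apply/fintype.subsetP => x; rewrite inE => /mem_take; rewrite mem_enum.
rewrite cardsE (card_uniqP _) ?take_uniq ?enum_uniq // size_take -cardE.
by case: ltngtP rA.
Qed.

(** Twice the number of edges that the link graph of [w] has inside [R], as [turan] counts them. *)
Definition link_sum (V : finType) (G : threegraph V) (R : {set V}) w : nat :=
  \sum_(x in R) \sum_(y in R) edge3 G w x y.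

Lemma link_sum_le (V : finType) (G : threegraph V) (R : {set V}) w :
  link_sum G R w <= #|R| ^ 2.
Proof.
rewrite -mulnn -sum_nat_const; apply: leq_sum => x _.
by rewrite -sum1_card; apply: leq_sum => y _; case: edge3.
Qed.

(** The last summand makes up for the diagonal pairs [x = y], which lie in no edge. *)
Lemma sum_link_sum (V : finType) (G : threegraph V) (R : {set V}) :
  #|R| ^ 2 * min_codegree G <= \sum_w link_sum G R w + #|R| * min_codegree G.
Proof.
rewrite /link_sum exchange_big /= -mulnn -mulnA -!sum_nat_const -big_split /=.
apply: leq_sum => x xR.
rewrite exchange_big /= (bigD1 x xR) /= addnC leq_add2r.
rewrite [leqRHS](bigD1 x xR) /=; apply: leq_trans (leq_addl _ _).
apply: leq_sum => y /andP[_ yx].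
by rewrite sum_edge3 min_codegree_le // eq_sym.
Qed.

(** The pigeonhole argument common to the base case and the induction step. If every [j]-set had
    fewer than [r] apexes, then, [R] having [2 ^ (4 * e)] subsets, few vertices would have a
    [j]-clique of their link inside [R]. All others weigh at most [M], which contradicts the total
    weight. *)
Lemma apexes_of_weight (V : finType) (G : threegraph V) (R : {set V})
    (j e r M : nat) (Wt : V -> nat) :
  0 < M -> 0 < e -> #|R| = 4 * e -> 4 * e * (2 ^ (4 * e) * r) < #|V| ->
  min_codegree G <= #|V| -> e.+1 * #|V| <= e * (3 * min_codegree G) ->
  (forall w, (forall K : {set V}, K \subset R -> clique (edge3 G w) K -> #|K| != j) ->
    Wt w <= M) ->
  (forall w, Wt w <= 3 * M) ->
  M * (4 * e * (3 * min_codegree G)) <=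
    4 * e * (\sum_w Wt w) + M * (2 * min_codegree G) ->
  exists2 K : {set V}, #|K| = j & r <= #|apexes G K|.
Proof.
move=> M0 e0 Re nbig dn dbig light heavy total.
have [/existsP[K /andP[/eqP Kj rK]]|/existsPn noK] :=
  boolP [exists K : {set V}, (#|K| == j) && (r <= #|apexes G K|)]; first by exists K.
exfalso.
pose Hv := [set w | [exists K : {set V},
  [&& K \subset R, clique (edge3 G w) K & #|K| == j]]].
have HvR : #|Hv| <= 2 ^ (4 * e) * r.
  rewrite -Re -card_powerset -sum_nat_const.
  apply: (@leq_trans (\sum_(K in powerset R) \sum_w ((#|K| == j) && (w \in apexes G K)))).
    rewrite exchange_big -sum1_card big_mkcond /=; apply: leq_sum => w _.
    case: ifP => //; rewrite inE => /existsP[K /and3P[KR cK Kj]].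
    by rewrite (bigD1 K) /= ?powersetE // Kj inE cK.
  apply: leq_sum => K _; have := noK K; rewrite negb_and -ltnNge.
  case: eqP => /= [_ /ltnW|_ _]; last by rewrite big1.
  apply: leq_trans; rewrite -sum1_card [leqRHS]big_mkcond.
  by apply: leq_sum => w _; case: (w \in _).
have sumW : \sum_w Wt w <= #|V| * M + 2 * M * #|Hv|.
  apply: (@leq_trans (\sum_w (M + 2 * M * (w \in Hv)))).
    apply: leq_sum => w _; case wH : (w \in Hv).
      by rewrite muln1 -mulSn; exact: heavy.
    rewrite muln0 addn0; apply: light => K KR cK; apply/negP => Kj.
    by move: wH; rewrite inE => /existsP[]; exists K; rewrite KR cK.
  rewrite big_split /= sum_nat_const leq_add2l -big_distrr leq_mul2l /=.
  by rewrite -[leqRHS]sum1_card [leqRHS]big_mkcond leq_sum ?orbT // => w _; case: (w \in _).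
have : 4 * e * #|Hv| <= 4 * e * (2 ^ (4 * e) * r) by rewrite leq_mul2l HvR orbT.
have {total} : M * (4 * e * (3 * min_codegree G)) <=
    M * (4 * e * (#|V| + 2 * #|Hv|) + 2 * min_codegree G).
  apply: leq_trans total _.
  rewrite [leqRHS]mulnDr leq_add2r mulnCA leq_mul2l.
  by apply/orP; right; rewrite mulnDr mulnCA (mulnA 2) (mulnC M #|V|) in sumW *; lia.
(* With [n = #|V|] and [d] the minimum codegree, the left side is at least [4en + 4n], while the
   right side is [4en + 8e #|Hv| + 2d] with [8e #|Hv| < 2n] and [2d <= 2n]. *)
rewrite leq_pmul2l //; lia.
Qed.

Lemma apexes3 (V : finType) (G : threegraph V) (e r : nat) :
  family_free F32_family G -> 0 < e ->
  4 * e * (2 ^ (4 * e) * r) + 12 * e < #|V| ->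
  min_codegree G <= #|V| -> e.+1 * #|V| <= e * (3 * min_codegree G) ->
  exists2 K : {set V}, #|K| = 3 & r <= #|apexes G K|.
Proof.
move=> /F32_freeP free e0 nbig dn dbig.
have V1 : 1 < #|V| by lia.
have [u [v [_ _ uv]]] := card_gt1P V1.
have d3 : #|V| <= 3 * min_codegree G.
  by rewrite -(leq_pmul2l e0); apply: leq_trans dbig; rewrite leq_mul2r leqnSn orbT.
(* The term [12 * e] of the threshold gives [3d >= n > 12e], so this neighbourhood has [4e]
   vertices. *)
have [|R RI Re] := @subset_card _ (nbhd G u v) (4 * e).
  by apply: leq_trans (min_codegree_le G uv); lia.
(* A triangle-free link contributes at most [#|R| ^ 2] to the first term by Turán. For neighbours of
   [u v] that term vanishes, which leaves room for the second. *)
pose Wt w := 2 * link_sum G R w + #|R| ^ 2 * (w \in nbhd G u v).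
have WI w : w \in nbhd G u v -> link_sum G R w = 0.
  rewrite inE => uvw; apply/eqP; rewrite sum_nat_eq0; apply/forall_inP => x xR.
  rewrite sum_nat_eq0; apply/forall_inP => y yR; rewrite eqb0.
  have := fintype.subsetP RI x xR; have := fintype.subsetP RI y yR.
  by rewrite !inE => uvy uvx; exact: (free u v).
apply: (@apexes_of_weight _ G R 3 e r (#|R| ^ 2) Wt) => //.
- by rewrite expn_gt0 Re muln_gt0 e0.
- by lia.
- move=> w noK; rewrite /Wt; case: (boolP (w \in nbhd G u v)) => [/WI->|_]; first by rewrite muln0 muln1.
  rewrite muln0 addn0 -[leqRHS]mul1n.
  by apply: turan => //; [exact: edge3_sym | exact: edge3_irr].
- move=> w; rewrite /Wt; case: (boolP (w \in nbhd G u v)) => [/WI->|_]; first by rewrite muln0 muln1; lia.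
  by have := link_sum_le G R w; lia.
have HI : \sum_w (w \in nbhd G u v) = #|nbhd G u v|.
  by rewrite -sum1_card [RHS]big_mkcond; apply: eq_bigr => w _; case: (w \in _).
rewrite /Wt big_split /= -!big_distrr /= HI -Re.
have := sum_link_sum G R; have := min_codegree_le G uv.
move: (\sum_w _) (min_codegree G) #|nbhd G u v| #|R| => h d i q.
rewrite -mulnn => di hd.
have A1 : q * (q * q * d) <= q * (q * q * i) by rewrite !leq_mul2l di !orbT.
have A2 : q * (q * q * d) <= q * (h + q * d) by rewrite leq_mul2l hd orbT.
lia.
Qed.

(** Put [M = k * #|R| ^ 2]. Each of the three parts of the weight totals about [M d], but freeness
    makes the three kinds of edges compete, so that a [w] without a large clique weighs at most [M]
    in all. *)
Lemma apexesS (V : finType) (G : threegraph V) (e r k : nat) (A : {set V}) :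
  family_free F32_family G -> 0 < e -> 2 < k -> #|A| = k -> 4 * e <= #|apexes G A| ->
  4 * e * (2 ^ (4 * e) * r) < #|V| ->
  min_codegree G <= #|V| -> e.+1 * #|V| <= e * (3 * min_codegree G) ->
  exists2 K : {set V}, #|K| = k.+1 & r <= #|apexes G K|.
Proof.
move=> /F32_freeP free e0 k2 Ak /subset_card[R RA Re] nbig dn dbig.
have apexE x a b : x \in R -> a \in A -> b \in A -> a != b -> edge3 G x a b.
  by move=> /(fintype.subsetP RA); rewrite inE => /cliqueP; exact.
have [a1 [a2 [a3 [[a1A a2A a3A] [a12 a23 a31]]]]] : exists x y z,
    [/\ x \in A, y \in A & z \in A] /\ [/\ x != y, y != z & z != x].
  by apply/card_gt2P; rewrite Ak.
(* A pair of [A] avoiding [l], available because [A] has three elements. *)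
pose p l := if l == a1 then (a2, a3) else if l == a2 then (a1, a3) else (a1, a2).
have pP l : [/\ (p l).1 \in A, (p l).2 \in A, (p l).1 != (p l).2,
    (p l).1 != l & (p l).2 != l].
  rewrite /p; case: (eqVneq l a1) => [->|la1] /=; first by split; rewrite // eq_sym.
  case: (eqVneq l a2) => [->|la2] /=; first by split; rewrite // eq_sym.
  by split; rewrite // eq_sym.
pose S w l := \sum_(x in R) edge3 G w x l.
pose F w l : nat := edge3 G w (p l).1 (p l).2.
(* The coefficients are chosen so that each kind of edge alone contributes at most
   [k * #|R| ^ 2]. *)
pose Wt w := k * link_sum G R w + #|R| * \sum_(l in A) (S w l + #|R| * F w l).
have S_le w l : S w l <= #|R|.
  by rewrite /S -sum1_card leq_sum // => x _; case: edge3.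
have F_le w l : F w l <= 1 by rewrite /F; case: edge3.
(* The pair (b, c) has the neighbours x, y, w. *)
have F0 w l x y : x \in R -> y \in R -> edge3 G w x y -> F w l = 0.
  move=> xR yR wxy; have [bA cA bc _ _] := pP l; apply/eqP; rewrite eqb0.
  apply/negP => wbc; have := free (p l).1 (p l).2 w x y.
  by rewrite -!(edge3_rot _ _ (p l).1) wbc wxy (apexE x) // (apexE y) // => /(_ isT isT isT).
(* The pair (x, w) has the neighbours y, l, m. *)
have deg1 w x y l m : x \in R -> y \in R -> edge3 G w x y -> l \in A -> m \in A ->
    edge3 G w x l -> edge3 G w x m -> l = m.
  move=> xR yR wxy lA mA wxl wxm; apply/eqP; apply: contraT => lm.
  by have := free w x y l m wxy wxl wxm; rewrite apexE.
(* The pair (x, l) has the neighbours b, c, w. *)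
have SF w l : l \in A -> S w l + #|R| * F w l <= #|R|.
  move=> lA; rewrite /F; case wbc : (edge3 G w _ _); last by rewrite muln0 addn0.
  have [bA cA bc bl cl] := pP l.
  rewrite (_ : S w l = 0) ?muln1 //; apply/eqP; rewrite sum_nat_eq0.
  apply/forall_inP => x xR; rewrite eqb0; apply/negP => wxl.
  rewrite eq_sym in bl; rewrite eq_sym in cl.
  have := free x l _ _ w (apexE x l _ xR lA bA bl) (apexE x l _ xR lA cA cl).
  by rewrite -!(edge3_rot _ w) wxl wbc => /(_ isT).
have R0 : 0 < #|R| by rewrite Re muln_gt0 e0.
apply: (@apexes_of_weight _ G R k.+1 e r (k * #|R| ^ 2) Wt) => //.
- by rewrite muln_gt0 expn_gt0 R0 (ltn_trans _ k2).
- move=> w noK; rewrite /Wt.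
  have [h0|[x [y [xR yR wxy]]]] : link_sum G R w = 0 \/
      exists x y, [/\ x \in R, y \in R & edge3 G w x y].
    have [/exists_inP[x xR /exists_inP[y yR wxy]]|no] :=
      boolP [exists x in R, exists y in R, edge3 G w x y]; first by right; exists x, y.
    left; apply/eqP; rewrite sum_nat_eq0; apply/forall_inP => x xR.
    rewrite sum_nat_eq0; apply/forall_inP => y yR; rewrite eqb0.
    by move: no; rewrite negb_exists_in => /forall_inP/(_ x xR)/exists_inPn/(_ y yR).
  + rewrite h0 muln0 add0n -mulnn mulnCA leq_mul2l; apply/orP; right.
    by rewrite -Ak -sum_nat_const; apply: leq_sum => l lA; exact: SF.
  (* The non-isolated vertices of the link inside [R]. They carry all its edges there, and by [deg1]
     each is joined to at most one vertex of [A]; hence Turán is applied to [P] instead of [R]. *)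
  pose P := [set x in R | [exists y in R, edge3 G w x y]].
  have PR : P \subset R by apply/fintype.subsetP => z; rewrite inE => /andP[].
  have PE a b : a \in R -> b \in R -> edge3 G w a b -> (a \in P) && (b \in P).
    move=> aR bR wab; rewrite !inE aR bR /=.
    by apply/andP; split; apply/exists_inP; [exists b | exists a => //; rewrite edge3_swap23].
  have hP : link_sum G R w = \sum_(a in P) \sum_(b in P) edge3 G w a b.
    rewrite /link_sum [RHS]big_mkcond [LHS]big_mkcond; apply: eq_bigr => a _.
    have [aP|aP] := boolP (a \in P); last first.
      case: ifP => // aR; rewrite big1 // => b bR; case wab : edge3 => //.
      by have := PE a b aR bR wab; rewrite (negbTE aP).
    rewrite (fintype.subsetP PR a aP) [LHS]big_mkcond [RHS]big_mkcond.
    apply: eq_bigr => b _; have [bP|bP] := boolP (b \in P).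
      by rewrite (fintype.subsetP PR b bP).
    case: ifP => // bR; case wab : edge3 => //.
    by have := PE a b (fintype.subsetP PR a aP) bR wab; rewrite (negbTE bP) andbF.
  have hT : k * link_sum G R w <= k.-1 * #|P| ^ 2.
    rewrite hP; case: k k2 noK {Ak Wt} => [|j] // _ noK.
    apply: turan => [||K KP]; [exact: edge3_sym | exact: edge3_irr |].
    by apply: noK; exact: fintype.subset_trans KP PR.
  have -> : \sum_(l in A) (S w l + #|R| * F w l) = \sum_(z in R) \sum_(l in A) edge3 G w z l.
    rewrite [RHS]exchange_big /=. apply: eq_bigr => l _.
    by rewrite (F0 w l x y) // muln0 addn0.
  have sP : \sum_(z in R) \sum_(l in A) edge3 G w z l <= #|P| + (#|R| - #|P|) * k.
    have -> : #|R| - #|P| = #|R :\: P|.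
      by rewrite cardsD (finset.setIidPr PR).
    rewrite (bigID (mem P)) /=; apply: leq_add.
      rewrite -sum1_card big_mkcond [leqRHS]big_mkcond; apply: leq_sum => z _.
      case: ifP => // /andP[zR zP]; rewrite [X in if X then _ else _]zP.
      move: zP; rewrite inE => /andP[_ /exists_inP[b bR wzb]].
      have [/exists_inP[l lA wzl]|no] := boolP [exists l in A, edge3 G w z l].
        rewrite (bigD1 l lA) /= wzl big1 // => m /andP[mA ml].
        case wzm : edge3 => //.
        by rewrite (deg1 w z b m l) ?eqxx // in ml.
      rewrite big1 // => l lA; case wzl : edge3 => //.
      by case/exists_inP: no; exists l.
    rewrite -sum_nat_const big_mkcond [leqRHS]big_mkcond; apply: leq_sum => z _.
    case: ifP => // /andP[zR zP]; rewrite finset.in_setD zR andbT.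
    rewrite [X in if X then _ else _]zP -Ak -sum1_card.
    by apply: leq_sum => l _; case: edge3.
  have := subset_leq_card PR.
  move: hT sP; move: (link_sum _ _ _) (\sum_(z in R) _) #|P| #|R| => h s q t.
  case: k k2 {Ak Wt noK} => // j _ /= hT sP qt.
  (* The claim becomes [jq^2 + (q+u)(q + (j+1)u) <= (j+1)(q+u)^2], which holds with slack [jqu]. *)
  have [u tE] : exists u, t = q + u by exists (t - q); rewrite subnKC.
  rewrite tE addKn in sP *.
  have {}sP : (q + u) * s <= (q + u) * (q + u * j.+1) by rewrite leq_mul2l sP orbT.
  apply: leq_trans (leq_add hT sP) _.
  by rewrite -!mulnn; lia.
- move=> w; rewrite /Wt.
  apply: (@leq_trans (k * #|R| ^ 2 + #|R| * (k * (#|R| + #|R|)))); last first.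
    by rewrite -mulnn; nia.
  apply: leq_add; first by rewrite leq_mul2l link_sum_le orbT.
  rewrite leq_mul2l; apply/orP; right; rewrite -Ak -sum_nat_const.
  apply: leq_sum => l _; apply: leq_add => //.
  by rewrite -[leqRHS]muln1 leq_mul2l F_le orbT.
have HS : k * (#|R| * min_codegree G) <= \sum_w \sum_(l in A) S w l.
  rewrite exchange_big /= -Ak -!sum_nat_const; apply: leq_sum => l lA.
  rewrite exchange_big /=; apply: leq_sum => x xR; rewrite sum_edge3.
  have [bA _ _ bl _] := pP l; rewrite eq_sym in bl.
  by have [+ _ _] := edge3_neq (apexE x l _ xR lA bA bl); exact: min_codegree_le.
have HF : k * min_codegree G <= \sum_w \sum_(l in A) F w l.
  rewrite exchange_big /= -Ak -!sum_nat_const; apply: leq_sum => l lA.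
  by rewrite sum_edge3; have [_ _ bc _ _] := pP l; exact: min_codegree_le.
have -> : \sum_w Wt w = k * (\sum_w link_sum G R w) + #|R| *
    (\sum_w \sum_(l in A) S w l + #|R| * \sum_w \sum_(l in A) F w l).
  rewrite /Wt big_split /= -!big_distrr /=; congr (_ + _ * _).
  rewrite big_distrr -big_split; apply: eq_bigr => w _.
  by rewrite big_split /= -big_distrr.
rewrite -Re; move: HS HF (sum_link_sum G R).
move: (\sum_w \sum_(l in A) S w l) (\sum_w \sum_(l in A) F w l) (\sum_w link_sum G R w).
move: (min_codegree G) #|R| => d q f g h HS HF Hh.
have {}Hh : k * (q ^ 2 * d) <= k * (h + q * d) by rewrite leq_mul2l Hh orbT.
have {}HS : q * (k * (q * d)) <= q * f by rewrite leq_mul2l HS orbT.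
have {}HF : q * (q * (k * d)) <= q * (q * g) by rewrite !leq_mul2l HF !orbT.
(* The three lower bounds add up to [3kq^2 d], short only of the diagonal term [kqd]; after
   multiplication by [q] this is within the permitted error [2kq^2 d]. *)
have T : k * (q ^ 2 * d) + q * (k * (q * d)) + q * (q * (k * d)) <=
  k * h + q * (f + q * g) + k * (q * d) by rewrite !mulnDr; lia.
have := leq_mul (leqnn q) T; rewrite -mulnn; lia.
Qed.

(** * The upper bound on [coex] *)

Lemma min_codegree_card (V : finType) (G : threegraph V) : min_codegree G <= #|V|.
Proof.
rewrite /min_codegree; elim/big_rec: _ => // p m _; exact: leq_trans (geq_minr _ _).
Qed.

(** Each extension step needs [4 * e] apexes of the smaller set, whatever [r] is wanted next, and
    raises the threshold for [#|V|]. *)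
Lemma apexes_large (e j r : nat) : 0 < e -> exists N, forall (V : finType) (G : threegraph V),
  N < #|V| -> family_free F32_family G -> e.+1 * #|V| <= e * (3 * min_codegree G) ->
  exists2 K : {set V}, #|K| = j.+3 & r <= #|apexes G K|.
Proof.
move=> e0; elim: j r => [|j IH] r.
  exists (4 * e * (2 ^ (4 * e) * r) + 12 * e) => V G nbig free dbig.
  exact: apexes3 free e0 nbig (min_codegree_card G) dbig.
have [N HN] := IH (4 * e).
exists (N + 4 * e * (2 ^ (4 * e) * r)) => V G nbig free dbig.
have [|A Aj rA] := HN V G _ free dbig; first by apply: leq_ltn_trans nbig; exact: leq_addr.
apply: apexesS free e0 _ Aj rA _ (min_codegree_card G) dbig => //.
by apply: leq_ltn_trans nbig; exact: leq_addl.
Qed.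

Lemma min_codegree_ub (e : nat) : 0 < e -> exists N, forall (V : finType) (G : threegraph V),
  N < #|V| -> family_free F32_family G -> e * (3 * min_codegree G) < e.+1 * #|V|.
Proof.
move=> e0; have [N HN] := apexes_large e 2 e0; exists N => V G nbig free.
rewrite ltnNge; apply/negP => dbig.
have [A Ae /card_gt1P[x [y [xA yA xy]]]] := HN V G nbig free dbig.
(* The set has [e + 3] vertices, so [k = e + 1]; with [dbig] this yields [(e+1)^2 n <= e(e+2) n],
   which is absurd for [n > 0]. *)
have := double_cone_bound free xy (k := e.+1) Ae xA yA.
have : e.+1 * (e.+1 * #|V|) <= e.+1 * (e * (3 * min_codegree G)) by rewrite leq_mul2l dbig orbT.
have V0 : 0 < #|V| by exact: leq_ltn_trans nbig.
move: V0; move: (min_codegree G) #|V| => d n; nia.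
Qed.

Lemma coex_ub (e : nat) : 0 < e -> exists N, forall n,
  N < n -> e * (3 * coex n F32_family) <= e.+1 * n.
Proof.
move=> e0; have [N HN] := min_codegree_ub e0; exists N => n Nn.
rewrite /coex; elim/big_rec: _ => [|G m free mn]; first by rewrite !muln0.
have [//|_] := leqP (min_codegree G) m.
have := HN 'I_n G; rewrite card_ord => H.
by apply: ltnW; apply: H => //; apply/asboolP.
Qed.

(** * The lower bound: the cyclic three-class construction *)

Definition cyc_pattern (i j k : 'I_3) : bool :=
  [exists l : 'I_3, ((i == l) + (j == l) + (k == l) == 2) &&
    ((i == ordS l) + (j == ordS l) + (k == ordS l) == 1)].

(** Membership is expressed by colour counts, so no order on the vertices of [e] has to be chosen;
    [ordS] is the cyclic successor. *)
Definition cyc_edges (V : finType) (c : V -> 'I_3) : {set {set V}} :=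
  [set e : {set V} | (#|e| == 3) && [exists l : 'I_3,
     (#|[set x in e | c x == l]| == 2) && (#|[set x in e | c x == ordS l]| == 1)]].

Lemma cyc_edges_card3 (V : finType) (c : V -> 'I_3) :
  [forall e in cyc_edges c, #|e| == 3].
Proof. by apply/forall_inP => e; rewrite inE => /andP[]. Qed.

Definition cyc_graph (V : finType) (c : V -> 'I_3) : threegraph V :=
  ThreeGraph (cyc_edges_card3 c).

Lemma edge3_cyc (V : finType) (c : V -> 'I_3) x y z :
  edge3 (cyc_graph c) x y z = uniq [:: x; y; z] && cyc_pattern (c x) (c y) (c z).
Proof.
rewrite /edge3 inE cards3; case u : (uniq _) => //=.
have cardE l : #|[set w in [set x; y; z] | c w == l]| =
    (c x == l) + (c y == l) + (c z == l).
  rewrite -sum1dep_card big_mkcondr /=.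
  rewrite (eq_bigl (mem [:: x; y; z])) => [|w]; last by rewrite !inE orbA.
  by rewrite -big_uniq //= !big_cons big_nil addn0 addnA; case: eqP; case: eqP; case: eqP.
by apply: eq_existsb => l; rewrite !cardE.
Qed.

Lemma cyc_patternE (i j k : 'I_3) : cyc_pattern i j k =
  [|| (i == j) && (k == ordS i), (i == k) && (j == ordS i) | (j == k) && (i == ordS j)].
Proof.
apply/idP/idP => [/existsP[l]|].
  by move: i j k l => [[|[|[|//]]] ?] [[|[|[|//]]] ?] [[|[|[|//]]] ?] [[|[|[|//]]] ?].
by case/or3P => /andP[/eqP-> /eqP->]; apply/existsP;
  [exists j | exists k | exists k]; move: j k => [[|[|[|//]]] ?] [[|[|[|//]]] ?].
Qed.

(** The colours of [x] and [y] determine the colour of any common neighbour, and no edge is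
    monochromatic. *)
Lemma cyc_graph_free (V : finType) (c : V -> 'I_3) : family_free F32_family (cyc_graph c).
Proof.
apply/F32_freeP => x y a b d; rewrite !edge3_cyc !cyc_patternE.
move=> /andP[_ +] /andP[_ +] /andP[_ +]; move=> Ha Hb Hd; rewrite negb_and; apply/orP; right.
move: (c x) (c y) (c a) (c b) (c d) Ha Hb Hd.
by move=> [[|[|[|//]]] ?] [[|[|[|//]]] ?] [[|[|[|//]]] ?] [[|[|[|//]]] ?] [[|[|[|//]]] ?].
Qed.

(** Some class [l] consists of neighbours of [x y], apart from [x] and [y] themselves. At most one
    of these lies in it, whence the strict inequality on class sizes. *)
Lemma leq_min_codegree_cyc (V : finType) (c : V -> 'I_3) d :
  d <= #|V| -> (forall l, d < #|[set x | c x == l]|) -> d <= min_codegree (cyc_graph c).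
Proof.
move=> dV H; apply: leq_min_codegree => // x y xy.
have [l [lxy lE]] : exists l, ~~ ((c x == l) && (c y == l)) /\
    forall z, z != x -> z != y -> c z = l -> edge3 (cyc_graph c) x y z.
  have [l Hl] : exists l, cyc_pattern (c x) (c y) l.
    case: (eqVneq (c x) (c y)) => [->|].
      by exists (ordS (c y)); rewrite cyc_patternE !eqxx.
    case: (eqVneq (c y) (ordS (c x))) => [->|].
      by exists (c x); rewrite cyc_patternE !eqxx orbT.
    (* In the remaining case the colour of [x] follows that of [y]. *)
    move=> yx nxy; exists (c y); rewrite cyc_patternE eqxx /=.
    by move: (c x) (c y) yx nxy => [[|[|[|//]]] ?] [[|[|[|//]]] ?].
  exists l; split => [|z zx zy zl].
    apply: contraL Hl => /andP[/eqP-> /eqP->]; rewrite cyc_patternE.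
    by move: l => [[|[|[|//]]] ?].
  rewrite edge3_cyc zl Hl /= !inE negb_or.
  by rewrite xy (eq_sym x) zx (eq_sym y) zy.
rewrite -ltnS; apply: leq_trans (H l) _.
pose w := if c x == l then x else y.
apply: (@leq_trans #|[set w] :|: nbhd (cyc_graph c) x y|); last first.
  by have [HU _] := leq_card_setU [set w] (nbhd (cyc_graph c) x y); rewrite cards1 in HU.
apply/subset_leq_card/fintype.subsetP => z; rewrite !inE => /eqP zl.
have [//|zw] := eqVneq z w; apply: (lE z _ _ zl).
  by apply: contraNneq zw => zx; rewrite /w -zx zl eqxx zx.
apply: contraNneq zw => zy; rewrite /w; move: lxy; rewrite -zy zl eqxx andbT.
by move=> /negbTE ->; rewrite zy.
Qed.

Lemma card_mod3 (n : nat) (l : 'I_3) :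
  n %/ 3 <= #|[set i : 'I_n | inord (i %% 3) == l]|.
Proof.
have lt (j : 'I_(n %/ 3)) : 3 * j + l < n.
  by case: j l => j jn [l l3] /=; lia.
rewrite -[leqLHS]card_ord -cardsT.
have inj : injective (fun j => Ordinal (lt j)).
  by move=> i j [] ij; apply: val_inj => /=; lia.
rewrite -(card_imset _ inj); apply/subset_leq_card/fintype.subsetP => i /imsetP[j _ ->].
rewrite inE -val_eqE /=; case: l lt inj => l l3 /= _ _.
by rewrite mulnC modnMDl modn_small // inordK.
Qed.

(** The constant 5 is 2 for rounding [n / 3] down plus 3 for the vertex lost in a class. *)
Lemma coex_lb (n : nat) : n <= 3 * coex n F32_family + 5.
Proof.
have [n3|n3] := leqP 3 n; last lia.
pose c (i : 'I_n) : 'I_3 := inord (i %% 3).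
have lb : n %/ 3 - 1 <= coex n F32_family.
  apply: (@leq_trans (min_codegree (cyc_graph c))).
    apply: leq_min_codegree_cyc => [|l]; first by rewrite card_ord; lia.
    by apply: leq_trans (card_mod3 n l); lia.
  rewrite /coex (bigD1 (cyc_graph c)) /=; last by apply/asboolP; exact: cyc_graph_free.
  exact: leq_maxl.
lia.
Qed.

(** * Passage to the limit *)

Local Open Scope classical_set_scope.
Local Open Scope ring_scope.

Theorem theorem1p2 (R : realType) :
  codegree_ratio R F32_family @ \oo --> (1 / 3 : R) /\
  codegree_density R F32_family = 1 / 3.
Proof.
suff cv : codegree_ratio R F32_family @ \oo --> (1 / 3 : R).
  by split => //; exact/cvg_lim.
apply/cvgrPdist_le => eps eps0.
have [e e_gt] : exists e : nat, 2 / eps < e%:R.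
  by exists (Num.truncn (2 / eps)).+1; exact: truncnS_gt.
have e0 : 0 < e%:R :> R by apply: lt_trans e_gt; rewrite divr_gt0.
have [N HN] := coex_ub (e := e) ltac:(by rewrite -(ltr_nat R)).
exists (N + e + 3)%N => // n /= Nn.
have n_e : e%:R + 3 <= n%:R :> R by rewrite -(natrD R e 3) ler_nat; lia.
have := coex_lb n; have := HN n ltac:(lia).
rewrite /codegree_ratio.
rewrite -(ler_nat R) !natrM -(natr1 e) => ub; rewrite -(ler_nat R) natrD natrM => lb.
move: (coex n F32_family)%:R (n%:R : R) (e%:R : R) n_e e_gt e0 ub lb => c m E mE Ee E0 ub lb.
have m0 : 0 < m - 2 by lra.
have Eeps : 2 < E * eps by rewrite -ltr_pdivrMr.
(* By [ub] the left side is at most [m + 2E], hence at most [3(m - 2)] since [m >= E + 3]; the right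
   side exceeds [6(m - 2)]. *)
have ub1 : E * (3 * c - (m - 2)) <= E * (eps * (3 * (m - 2))).
  have : 2 * (m - 2) <= E * eps * (m - 2) by rewrite ler_pM2r // ltW.
  by lra.
rewrite ler_pM2l // in ub1.
(* By [lb] the right side is at least -3, and [eps * (m - 2) >= E * eps > 2]. *)
have lb1 : - (eps * (3 * (m - 2))) <= 3 * c - (m - 2).
  have : E * eps <= (m - 2) * eps by rewrite ler_pM2r //; lra.
  by lra.
have -> : 1 / 3 - c / (m - 2) = - (3 * c - (m - 2)) / (3 * (m - 2)).
  by field; lra.
rewrite normrM normrN normfV [X in _ / X]gtr0_norm ?mulr_gt0 //.
by rewrite ler_pdivrMr ?mulr_gt0 // ler_norml lb1 ub1.
Qed.
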